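(* Let $P_3=NEEN$ and $P_4=ENNE$, and for $k\in\{3,4\}$ let $$F_k(x,t)=1+\sum_{n\ge 1}t^n\sum_{L\in\mathcal{L}_n}x^{P_k\text{-mch}(L)}.$$ Then $$F_3(x,t)=F_4(x,t)=\frac{2}{2t(x-1)+(\sqrt{1-4t}-1)x+\sqrt{1-4t}+1}.$$
   Context: $\mathcal{L}_n$ is the set of lattice paths from $(0,0)$ to $(n,n)$ consisting of unit north steps $N$ and unit east steps $E$, equivalently words with $n$ letters $E$ and $n$ letters $N$. For $L\in\mathcal{L}_n$ and $A\subseteq\{1,\dots,n\}$, $ps_L(A)$ is the word obtained from $L$ by deleting, for every $i\in\{1,\dots,n\}\setminus A$, the $i$-th occurrence of $E$ and the $i$-th occurrence of $N$ (reading from left to right). For $P\in\mathcal{L}_2$, $P\text{-mch}(L)$ is the number of $j\in\{1,\dots,n-1\}$ with $ps_L(\{j,j+1\})=P$. Identities are between formal power series in $t$ with coefficients polynomial in $x$; $\sqrt{1-4t}$ denotes the formal power series square root with constant term $1$. *)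

(* Defs.v *)
From HB Require Import structures.
From mathcomp Require Import all_boot all_algebra.
From mathcomp Require Import boolp classical_sets.

Set Implicit Arguments.
Unset Strict Implicit.
Unset Printing Implicit Defensive.

Import GRing.Theory.
Local Open Scope ring_scope.

Record fps (R : Type) : Type := Fps { fps_coef :> nat -> R }.

Lemma fpsP (R : Type) (f g : fps R) : (forall n, f n = g n) -> f = g.
Proof.
by case: f g => f [g] /= fg; congr Fps; apply: functional_extensionality_dep.
Qed.

HB.instance Definition _ (R : Type) := gen_eqMixin (fps R).
HB.instance Definition _ (R : Type) := gen_choiceMixin (fps R).

(* The sequence u such that u n = step [:: u 0; ...; u n.-1] for all n.       *)
Section StrongRecursion.
Variables (R : Type) (step : seq R -> R).

Fixpoint strong_seq n : seq R :=
  if n is m.+1 then rcons (strong_seq m) (step (strong_seq m)) else [::].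

Definition strong_rec n : R := step (strong_seq n).

Lemma strong_seqE n : strong_seq n = mkseq strong_rec n.
Proof. by elim: n => //= n IHn; rewrite mkseqS -IHn. Qed.

Lemma strong_recE n : strong_rec n = step (mkseq strong_rec n).
Proof. by rewrite -strong_seqE. Qed.

End StrongRecursion.

Section FpsRing.
Variable R : comUnitRingType.
Implicit Types f g h : fps R.

Definition fpsC (c : R) : fps R := Fps (fun n => if n == 0%N then c else 0).
Definition fpsT : fps R := Fps (fun n => (n == 1%N)%:R).

Definition fps_add f g : fps R := Fps (fun n => f n + g n).
Definition fps_opp f : fps R := Fps (fun n => - f n).
Definition fps_mul f g : fps R :=
  Fps (fun n => \sum_(i < n.+1) f i * g (n - i)%N).

Fact fps_addA : associative fps_add.
Proof. by move=> f g h; apply: fpsP => n /=; rewrite addrA. Qed.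
Fact fps_addC : commutative fps_add.
Proof. by move=> f g; apply: fpsP => n /=; rewrite addrC. Qed.
Fact fps_add0 : left_id (fpsC 0) fps_add.
Proof. by move=> f; apply: fpsP => n /=; rewrite if_same add0r. Qed.
Fact fps_addN : left_inverse (fpsC 0) fps_opp fps_add.
Proof. by move=> f; apply: fpsP => n /=; rewrite if_same addNr. Qed.

HB.instance Definition _ :=
  GRing.isZmodule.Build (fps R) fps_addA fps_addC fps_add0 fps_addN.

Definition fps_trunc N f : {poly R} := \poly_(i < N) f i.

Fact coef_fps_trunc N f k : (k < N)%N -> (fps_trunc N f)`_k = f k.
Proof. by move=> kN; rewrite coef_poly kN. Qed.

Fact fps_mulE N f g k : (k < N)%N ->
  fps_mul f g k = (fps_trunc N f * fps_trunc N g)`_k.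
Proof.
move=> kN; rewrite coefM /=; apply: eq_bigr => i _.
by rewrite !coef_fps_trunc // (leq_ltn_trans _ kN) ?leq_subr // -ltnS.
Qed.

Fact fps_mulC : commutative fps_mul.
Proof.
by move=> f g; apply: fpsP => n; rewrite !(@fps_mulE n.+1) // mulrC.
Qed.

Fact fps_mulA : associative fps_mul.
Proof.
move=> f g h; apply: fpsP => n.
transitivity ((fps_trunc n.+1 f * (fps_trunc n.+1 g * fps_trunc n.+1 h))`_n).
  rewrite coefM; apply: eq_bigr => i _; congr (_ * _).
    by rewrite coef_fps_trunc.
  by rewrite (@fps_mulE n.+1) // ltnS leq_subr.
rewrite mulrA coefM; apply: eq_bigr => i _; congr (_ * _).
  by rewrite (@fps_mulE n.+1).
by rewrite coef_fps_trunc // ltnS leq_subr.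
Qed.

Fact fps_mul1 : left_id (fpsC 1) fps_mul.
Proof.
move=> f; apply: fpsP => n /=; rewrite big_ord_recl /= mul1r subn0.
by rewrite big1 ?addr0 // => i _; rewrite mul0r.
Qed.

Fact fps_mulD : left_distributive fps_mul fps_add.
Proof.
move=> f g h; apply: fpsP => n /=; rewrite -big_split.
by apply: eq_bigr => i _; rewrite /= mulrDl.
Qed.

Fact fps_1_neq0 : fpsC 1 != 0.
Proof.
apply/eqP => /(congr1 (fun f => fps_coef f 0%N)) /= /eqP.
by rewrite oner_eq0.
Qed.

HB.instance Definition _ := GRing.Zmodule_isComNzRing.Build (fps R)
  fps_mulA fps_mulC fps_mul1 fps_mulD fps_1_neq0.

Lemma fps0E n : (0 : fps R) n = 0.
Proof. exact: if_same. Qed.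

Lemma fps1E n : (1 : fps R) n = (n == 0%N)%:R.
Proof. by case: n. Qed.

Lemma fpsDE f g n : (f + g) n = f n + g n. Proof. by []. Qed.

Lemma fpsNE f n : (- f) n = - f n. Proof. by []. Qed.

Lemma fpsME f g n : (f * g) n = \sum_(i < n.+1) f i * g (n - i)%N.
Proof. by []. Qed.

Fact fpsC_is_zmod_morphism : zmod_morphism fpsC.
Proof. by move=> a b; apply: fpsP => -[|n] //=; rewrite oppr0 addr0. Qed.

Fact fpsC_is_monoid_morphism : monoid_morphism fpsC.
Proof.
split=> // a b; apply: fpsP => n; rewrite fpsME big_ord_recl /= subn0.
rewrite big1 ?addr0 => [|i _]; last by rewrite mul0r.
by case: n => //= n; rewrite mulr0.
Qed.

HB.instance Definition _ :=
  GRing.isZmodMorphism.Build R (fps R) fpsC fpsC_is_zmod_morphism.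
HB.instance Definition _ :=
  GRing.isMonoidMorphism.Build R (fps R) fpsC fpsC_is_monoid_morphism.

Definition fps_unit : pred (fps R) := fun f => f 0%N \is a GRing.unit.

Definition fps_inv_coef f : nat -> R := strong_rec (fun s =>
  (f 0%N)^-1 *
    ((size s == 0%N)%:R - \sum_(i < size s) s`_i * f (size s - i)%N)).

(* As required of inverses in a unitRingType, non-units are left unchanged.   *)
Definition fps_inv f : fps R := if fps_unit f then Fps (fps_inv_coef f) else f.

Fact fps_mulV : {in fps_unit, left_inverse 1 fps_inv *%R}.
Proof.
move=> f Uf; have Uf0 : f 0%N \is a GRing.unit := Uf.
rewrite /fps_inv (Uf : fps_unit f = true); apply: fpsP => n.
rewrite fps1E fpsME big_ord_recr /= subnn {2}/fps_inv_coef strong_recE.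
rewrite size_mkseq mulrAC mulVr // mul1r addrC.
under [X in _ - X]eq_bigr => i _ do rewrite nth_mkseq ?ltn_ord //.
by rewrite subrK.
Qed.

Fact fps_unitPl f g : g * f = 1 -> fps_unit f.
Proof.
move=> /(congr1 (fun h => fps_coef h 0%N)) /=; rewrite big_ord1 /= => gf1.
by apply/unitrPr; exists (g 0%N); rewrite mulrC.
Qed.

Fact fps_inv_out : {in [predC fps_unit], fps_inv =1 id}.
Proof. by move=> f nUf; rewrite /fps_inv (negbTE (nUf : ~~ fps_unit f)). Qed.

HB.instance Definition _ := GRing.ComNzRing_hasMulInverse.Build (fps R)
  fps_mulV fps_unitPl fps_inv_out.

Lemma fps_unitE f : (f \is a GRing.unit) = (f 0%N \is a GRing.unit).
Proof. by []. Qed.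

(* Only meaningful when such a g exists and is unique, which holds if 2 is    *)
(* invertible and f has constant term 1: see fps_sqrtP and fps_sqrt_unique.   *)
Definition fps_sqrt f : fps R :=
  xget 0 [set g : fps R | g 0%N = 1 /\ g ^+ 2 = f].

Definition fps_sqrt_coef f : nat -> R := strong_rec (fun s =>
  if size s is n.+1 then
    2^-1 * (f n.+1 - \sum_(i < n) s`_i.+1 * s`_(n - i))
  else 1).

Lemma fps_sqrtP f : (2 : R) \is a GRing.unit -> f 0%N = 1 ->
  fps_sqrt f 0%N = 1 /\ fps_sqrt f ^+ 2 = f.
Proof.
move=> U2 f0; apply: (@xgetPex _ 0 [set g : fps R | g 0%N = 1 /\ g ^+ 2 = f]).
exists (Fps (fps_sqrt_coef f)); split=> //.
have c0 : fps_sqrt_coef f 0%N = 1 by [].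
apply: fpsP => -[|n]; first by rewrite expr2 fpsME big_ord1 /= c0 mulr1.
rewrite expr2 fpsME big_ord_recl big_ord_recr /= c0 /bump /= subn0.
rewrite add1n subnn c0 mul1r mulr1 addrCA -mulr2n -mulr_natl.
have -> : fps_sqrt_coef f n.+1 = 2^-1 * (f n.+1 -
    \sum_(i < n) fps_sqrt_coef f i.+1 * fps_sqrt_coef f (n - i)%N).
  rewrite /fps_sqrt_coef strong_recE size_mkseq; congr (_ * (_ - _)).
  by apply: eq_bigr => i _; rewrite !nth_mkseq ?ltnS ?leq_subr.
rewrite mulVKr // addrC -addrA -[RHS]addr0; congr (_ + _).
rewrite addrC; apply/eqP; rewrite subr_eq0; apply/eqP.
by apply: eq_bigr => i _; rewrite add1n subSS.
Qed.

Lemma fps_sqrt_unique f g : (2 : R) \is a GRing.unit ->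
  g 0%N = 1 -> g ^+ 2 = f -> fps_sqrt f = g.
Proof.
move=> U2 g0 gf; apply: xget_unique => // h [h0 hf].
have /eqP : (h - g) * (h + g) = 0 by rewrite -subr_sqr hf gf subrr.
have U : h + g \is a GRing.unit.
  by rewrite fps_unitE fpsDE h0 g0 -[1 + 1]/(2 : R).
rewrite mulIr_eq0; last exact: mulIr.
by rewrite subr_eq0 => /eqP.
Qed.

End FpsRing.

Arguments fpsT {R}.

Inductive step : predArgType := N | E.

Definition bool_of_step (a : step) : bool := if a is E then true else false.
Definition step_of_bool (b : bool) : step := if b then E else N.

Fact bool_of_stepK : cancel bool_of_step step_of_bool. Proof. by case. Qed.

HB.instance Definition _ := Finite.copy step (can_type bool_of_stepK).

Definition lattice_paths (n : nat) : {set (n + n).-tuple step} :=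
  [set L : (n + n).-tuple step | (count_mem E L == n) && (count_mem N L == n)].

(* The letter in position p (from 0) of L is the (occ L p)-th occurrence      *)
(* (from 1) of that letter in L.                                              *)
Definition occ (L : seq step) (p : nat) : nat :=
  count_mem (nth N L p) (take p.+1 L).

Definition ps (L : seq step) (A : {pred nat}) : seq step :=
  [seq nth N L p | p <- iota 0 (size L) & occ L p \in A].

Definition mch (P : seq step) (n : nat) (L : seq step) : nat :=
  count (fun j => ps L (pred2 j j.+1) == P) (index_iota 1 n).

Definition P3 : seq step := [:: N; E; E; N].
Definition P4 : seq step := [:: E; N; N; E].

(* The coefficients are polynomials over the rationals, so that 2 is a unit.  *)
Definition F (P : seq step) : fps {poly rat} :=
  Fps (fun n => if n == 0%N then 1
                else \sum_(L in lattice_paths n) 'X ^+ mch P n L).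

(* Main.v *)
Require Import Defs.
From mathcomp Require Import all_boot all_algebra.
From mathcomp Require Import ring zify.

Set Implicit Arguments.
Unset Strict Implicit.
Unset Printing Implicit Defensive.

Import GRing.Theory.
Local Open Scope ring_scope.

(* Exchanging the letters E and N turns NEEN into ENNE, hence F_3 = F_4.
   For ENNE, the j-th pair matches iff L passes through (j,j) by two consecutive
   letters N: E_j < N_j puts the j-th N weakly below the diagonal and
   N_{j+1} < E_{j+1} puts the next one weakly above it.  So L is a sequence of
   arches below and above the diagonal, each counted by D = (1 - s) / 2 = t C
   with C the Catalan series, and x marks each arch below followed by one above.
   This gives F_4 = 1 / (1 - 2 D - (x - 1) D^2). *)

(* [ps_from i k L A] is the part of [ps] contributed by a suffix [L] that is
   preceded by [i] letters E and [k] letters N. *)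
Fixpoint ps_from (i k : nat) (L : seq step) (A : {pred nat}) : seq step :=
  match L with
  | [::] => [::]
  | E :: L' => if i.+1 \in A then E :: ps_from i.+1 k L' A
               else ps_from i.+1 k L' A
  | N :: L' => if k.+1 \in A then N :: ps_from i k.+1 L' A
               else ps_from i k.+1 L' A
  end.

(** The prefix [M] is arbitrary so that induction on [L] can move letters into it while positions
    stay absolute. *)
Lemma ps_cat (M L : seq step) (A : {pred nat}) :
  [seq nth N (M ++ L) p | p <- iota (size M) (size L) & occ (M ++ L) p \in A] =
  ps_from (count_mem E M) (count_mem N M) L A.
Proof.
elim: L M => [|a L IHL] M //=.
have := IHL (rcons M a); rewrite cat_rcons size_rcons -cats1 !count_cat /=.
have -> : occ (M ++ a :: L) (size M) = (count_mem a M).+1.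
  rewrite /occ nth_cat ltnn subnn /= take_cat ltnNge leqnSn /= subSnn /= take0.
  by rewrite count_cat /= eqxx addn0 addn1.
have aE : nth N (M ++ a :: L) (size M) = a by rewrite nth_cat ltnn subnn.
by case: a {IHL} aE => aE; rewrite /= !addn0 addn1 => <-; case: ifP; rewrite //= aE.
Qed.

Lemma ps_ps_from (L : seq step) (A : {pred nat}) : ps L A = ps_from 0 0 L A.
Proof. exact: (ps_cat [::]). Qed.

(** * Exchange of the two letters *)

Definition swap (a : step) : step := if a is E then N else E.

Lemma swapK : involutive swap. Proof. by case. Qed.

Lemma count_mem_swap (a : step) (L : seq step) :
  count_mem a (map swap L) = count_mem (swap a) L.
Proof. by rewrite count_map; apply: eq_count; case: a; case. Qed.

Lemma ps_from_swap (i k : nat) (L : seq step) (A : {pred nat}) :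
  ps_from k i (map swap L) A = map swap (ps_from i k L A).
Proof. by elim: L i k => [|[] L IHL] i k //=; case: ifP; rewrite /= IHL. Qed.

Lemma mch_swap (P : seq step) (n : nat) (L : seq step) :
  mch (map swap P) n (map swap L) = mch P n L.
Proof.
apply: eq_count => j; rewrite !ps_ps_from ps_from_swap.
by rewrite (inj_eq (inj_map (inv_inj swapK))).
Qed.

Lemma F_swap (P : seq step) : F (map swap P) = F P.
Proof.
apply: fpsP => -[|n] //=.
pose sw (L : (n.+1 + n.+1).-tuple step) := map_tuple swap L.
have swK : involutive sw by move=> L; apply: val_inj; apply: (mapK swapK).
rewrite (reindex_inj (inv_inj swK)) /=.
apply: eq_big => [L|L _]; last by rewrite mch_swap.
by rewrite !inE !count_mem_swap andbC.
Qed.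

(** * Matches of ENNE as diagonal crossings *)

(* Counts the factors NN of [L] whose middle point lies on the diagonal, where
   [b] tells whether [L] is preceded by a letter N.  The position is on the
   diagonal when as many letters E as letters N remain. *)
Fixpoint crossings (b : bool) (L : seq step) : nat :=
  if L is a :: L' then
    ([&& b, a == N & count_mem E L == count_mem N L] +
      crossings (a == N) L')%N
  else 0%N.

(* The crossings at (j,j), for a suffix [L] that starts at the point (i,k). *)
Fixpoint crossings_at (j i k : nat) (b : bool) (L : seq step) : nat :=
  match L with
  | [::] => 0%N
  | E :: L' => crossings_at j i.+1 k false L'
  | N :: L' => ([&& b, i == j & k == j] + crossings_at j i k.+1 true L')%N
  end.

Lemma eq_stepE :
  ((E == E) = true) * ((N == N) = true) * ((E == N) = false) * ((N == E) = false).
Proof. by []. Qed.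

(* Simplification puts all occurrences of [count_mem] in the same form, so that
   [lia] identifies them. *)
Ltac count_lia := simpl in *; lia.

(** A crossing at (k,k) is counted only for j = k, and 1 <= k < n because one N precedes it and
    another follows. *)
Lemma sum_crossings_at (n i k : nat) (b : bool) (L : seq step) :
  (i + count_mem E L = n)%N -> (k + count_mem N L = n)%N -> (b ==> (0 < k))%N ->
  (\sum_(1 <= j < n) crossings_at j i k b L = crossings b L)%N.
Proof.
elim: L i k b => [|[] L IHL] i k b; rewrite /= ?eq_stepE; first by move=> *; rewrite big1.
- move=> En Nn bk; rewrite big_split /= IHL //; last by count_lia.
  congr (_ + _)%N.
  have -> : (0 + count_mem E L == 1 + count_mem N L)%N = (i == k) by count_lia.
  case: b bk => /= [k0|_]; last by rewrite big1.
  have [-> /=|ik /=] := eqVneq i k.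
    rewrite (bigD1_seq k) ?iota_uniq ?mem_index_iota //=; last by count_lia.
    by rewrite eqxx big1 // => j /negPf; rewrite eq_sym => ->.
  by rewrite big1 // => j _; case: (i =P j) => //= <-; rewrite eq_sym (negPf ik).
- move=> En Nn bk; rewrite andbF add0n; apply: IHL => //; count_lia.
Qed.

Lemma crossings_at_past (j i k : nat) (b : bool) (L : seq step) :
  (j < i)%N || (j < k)%N -> crossings_at j i k b L = 0%N.
Proof.
elim: L i k b => [|[] L IHL] i k b //= jik; rewrite IHL //; count_lia.
Qed.

(** The first coordinate reaches j by an E, at height at least j, so (j,j) cannot be the middle of a
    factor NN. *)
Lemma crossings_at_above (j i k : nat) (b : bool) (L : seq step) :
  (i < j <= k)%N -> crossings_at j i k b L = 0%N.
Proof.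
elim: L i k b => [|a L IHL] i k b // /andP[ij jk].
case: a => /=.
  by rewrite IHL ?ij ?(leqW jk) // (ltn_eqF ij) andbF.
case: (ltnP i.+1 j) => [ij1|ji1]; first by rewrite IHL ?ij1.
case: L {IHL} => [|[] L] //=; rewrite crossings_at_past //; count_lia.
Qed.

(** Of the four retained letters, only the (j+1)-st E is still to come. *)
Lemma ps_from_last_E (j k : nat) (L : seq step) :
  (j < k)%N -> (0 < count_mem E L)%N ->
  ps_from j k L (pred2 j j.+1) = [:: E].
Proof.
have none i : (j < i)%N -> forall k' M, (j < k')%N ->
    ps_from i k' M (pred2 j j.+1) = [::].
  move=> ji k' M; elim: M i k' ji => [|[] M IHM] i k' ji jk //=;
    rewrite !inE ifN ?IHM //; count_lia.
elim: L k => [|[] L IHL] k jk //=; rewrite ?eq_stepE => EL; rewrite !inE.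
  by rewrite ifN ?IHL //; count_lia.
by rewrite eqxx orbT none.
Qed.

(** The main induction runs up to the first retained letter; [S1] takes over after the j-th E, and
    [S2] at (j,j) after the j-th N. *)
Lemma ps_from_ENNE (j i k : nat) (b : bool) (L : seq step) :
  (i < j)%N -> (k < j)%N -> (j < i + count_mem E L)%N ->
  (ps_from i k L (pred2 j j.+1) == P4) = crossings_at j i k b L :> nat.
Proof.
have S2 (M : seq step) : (0 < count_mem E M)%N ->
    (ps_from j j M (pred2 j j.+1) == [:: N; E]) = crossings_at j j j true M
      :> nat.
  case: M => [|[] M] //=; rewrite ?eq_stepE => EM; rewrite !inE eqxx orbT.
    by rewrite ps_from_last_E // !eqxx crossings_at_past ?ltnSn ?orbT.
  by rewrite crossings_at_past ?ltnSn.
have S1 (M : seq step) k' c : (k' < j)%N -> (0 < count_mem E M)%N ->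
    (ps_from j k' M (pred2 j j.+1) == [:: N; N; E]) = crossings_at j j k' c M
      :> nat.
  elim: M k' c => [|[] M IHM] k' c k'j //=; rewrite ?eq_stepE => EM; rewrite !inE.
    rewrite (ltn_eqF k'j) !andbF add0n eqSS (ltn_eqF k'j) orbF.
    have [k'j1|k'j1] := eqVneq k'.+1 j; last first.
      by rewrite (IHM _ true) //; count_lia.
    by rewrite k'j1 -S2.
  by rewrite eqxx orbT crossings_at_past ?ltnSn.
elim: L i k b => [|[] L IHL] i k b ij kj; rewrite /= ?eq_stepE => EL.
  by count_lia.
  rewrite !inE (ltn_eqF ij) !andbF add0n eqSS (ltn_eqF kj) orbF.
  (* If the j-th N precedes the j-th E, both sides vanish. *)
  have [kj1|kj1] := eqVneq k.+1 j; last by apply: IHL; count_lia.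
  by rewrite crossings_at_above // kj1 leqnn ij.
rewrite !inE eqSS (ltn_eqF ij) orbF.
have [ij1|ij1] := eqVneq i.+1 j; last by apply: IHL; count_lia.
by rewrite ij1 -S1 //; count_lia.
Qed.

Lemma mch_P4_crossings (n : nat) (L : seq step) :
  count_mem E L = n -> count_mem N L = n -> mch P4 n L = crossings false L.
Proof.
move=> EL NL; rewrite -(@sum_crossings_at n 0 0) // /mch -sum1_count big_mkcond.
apply: eq_big_nat => j /andP[j0 jn].
by rewrite ps_ps_from -(@ps_from_ENNE j 0 0) ?add0n ?EL //; case: eqP.
Qed.

(** * Weighted path counts and their generating functions *)

Lemma big_tuple_step (R : nmodType) (m : nat) (P : pred (seq step))
    (f : seq step -> R) :
  \sum_(L : m.+1.-tuple step | P L) f L =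
  \sum_(L : m.-tuple step | P (E :: L)) f (E :: L) +
  \sum_(L : m.-tuple step | P (N :: L)) f (N :: L).
Proof.
pose cons_pair (u : step * m.-tuple step) := cons_tuple u.1 u.2.
rewrite (reindex cons_pair); last first.
  exists (fun L : m.+1.-tuple step => (thead L, behead_tuple L)) => [[a L] _|L _].
    by congr pair; apply: val_inj.
  by rewrite [RHS]tuple_eta; apply: val_inj.
rewrite -(pair_big_dep xpredT (fun a (L : m.-tuple step) => P (a :: L))
  (fun a (L : m.-tuple step) => f (a :: L))) /=.
by rewrite (bigD1 E) //= (big_pred1 N) //; case.
Qed.

Section CrossingSums.
Variables (R : comUnitRingType) (x : R).

Definition crossing_sum (b : bool) (m e n : nat) : R :=
  \sum_(L : m.-tuple step | (count_mem E L == e) && (count_mem N L == n))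
    x ^+ crossings b L.

Lemma crossing_sum0 (b : bool) : crossing_sum b 0 0 0 = 1.
Proof.
rewrite /crossing_sum (big_pred1 [tuple]) // => L.
by rewrite (tuple0 L) !inE.
Qed.

Lemma crossing_sumS (b : bool) (m e n : nat) :
  crossing_sum b m.+1 e n =
  (if e is e'.+1 then crossing_sum false m e' n else 0) +
  (if n is n'.+1 then (if b && (e == n) then x else 1) *
     crossing_sum true m e n' else 0).
Proof.
rewrite /crossing_sum (big_tuple_step _
  (fun L => (count_mem E L == e) && (count_mem N L == n))
  (fun L => x ^+ crossings b L)) /=; congr (_ + _).
  case: e => [|e]; first by rewrite big1.
  by apply: eq_big => [L|L _]; rewrite ?add1n ?add0n ?eqSS // andbF.
case: n => [|n]; first by rewrite big1 // => L; rewrite andbF.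
rewrite big_distrr /=; apply: eq_big => [L|L]; first by rewrite add0n add1n eqSS.
move=> /andP[/eqP-> /eqP->]; rewrite exprD.
by congr (_ * _); case: b; case: eqP.
Qed.

End CrossingSums.

Lemma fps_mulT (R : comUnitRingType) (f : fps R) (n : nat) :
  (fpsT * f) n = if n is m.+1 then f m else 0.
Proof.
case: n => [|n]; rewrite fpsME; first by rewrite big_ord1 /= mul0r.
rewrite big_ord_recl big_ord_recl /= big1 => [|i _]; last by rewrite mul0r.
by rewrite mul0r mul1r add0r addr0 subn1.
Qed.

Lemma fps_mul0E (R : comUnitRingType) (f g : fps R) :
  (f * g) 0%N = f 0%N * g 0%N.
Proof. by rewrite fpsME big_ord1. Qed.

Lemma fps_mulCE (R : comUnitRingType) (c : R) (f : fps R) (n : nat) :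
  (fpsC c * f) n = c * f n.
Proof.
rewrite fpsME big_ord_recl /= subn0 big1 ?addr0 // => i _.
by rewrite mul0r.
Qed.

(* [C] is the Catalan series, so that [C ^+ h] counts the paths descending by
   [h] to their first visit of the diagonal; [Gt] and [Gf] count the paths
   from the diagonal, preceded by a letter N or not.  The three equations are
   those of first-return decompositions; as the recursion [crossing_sumS]
   determines everything, they need no bijective proof. *)
Lemma crossing_sum_fps (R : comUnitRingType) (x : R) (C Gt Gf : fps R) :
  C = 1 + fpsT * C ^+ 2 ->
  Gf = 1 + fpsT * (C * Gt + C * Gf) ->
  Gt = 1 + fpsT * (C * Gt + fpsC x * (C * Gf)) ->
  forall (b : bool) (m e n : nat), m = (e + n)%N ->
  crossing_sum x b m e n =
    if (e < n)%N then (C ^+ (n - e) * Gt) e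
    else if (n < e)%N then (C ^+ (e - n) * Gf) n
    else (if b then Gt else Gf) e.
Proof.
move=> CE GfE GtE.
(* Off the diagonal, each letter changes the distance to it by one; this is the matching recursion
   for powers of [C]. *)
have powS h (G : fps R) k : (C ^+ h.+1 * G) k =
    (if k is k'.+1 then (C ^+ h.+2 * G) k' else 0) + (C ^+ h * G) k.
  rewrite -fps_mulT -fpsDE; congr (fps_coef _ k).
  rewrite exprS {1}CE !exprS; ring.
have Gf0 : Gf 0%N = 1 by rewrite GfE fpsDE fps_mulT fps1E addr0.
have Gt0 : Gt 0%N = 1 by rewrite GtE fpsDE fps_mulT fps1E addr0.
move=> b m; elim: m b => [|m IHm] b e n.
  case: e => [|e]; case: n => [|n] // _.
  by rewrite crossing_sum0 /=; case: b; rewrite ?Gf0 ?Gt0.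
move=> men; rewrite crossing_sumS.
(* With more N than E left, the diagonal is regained by an N, hence [Gt]; in the opposite case by an
   E, hence [Gf]. *)
have [en|ne|en] := ltngtP e n.
- case: n en men => // n en men; rewrite andbF mul1r subSn // powS.
  congr (_ + _).
    case: e en men => // e en men; rewrite IHm; last by lia.
    by rewrite (_ : e < n.+1)%N; [congr (fps_coef (C ^+ _ * _) _)|]; lia.
  rewrite IHm; last by lia.
  have [//|//|->] := ltngtP e n; first by lia.
  by rewrite subnn mul1r.
- case: e ne men => // e ne men; rewrite andbF subSn // powS addrC.
  congr (_ + _).
    case: n ne men => // n ne men; rewrite mul1r IHm; last by lia.
    rewrite ifF; last by lia.
    by rewrite (_ : n < e.+1)%N; [congr (fps_coef (C ^+ _ * _) _)|]; lia.
  rewrite IHm; last by lia.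
  have [|//|->] := ltngtP e n; first by lia.
  by rewrite subnn mul1r.
- case: n en men => [|n] en men; first by rewrite en in men.
  rewrite en andbT !IHm; try lia.
  rewrite ltnSn ltnNge leqnSn /= subSnn expr1.
  case: b => /=; rewrite [in RHS](GtE, GfE) fpsDE fps1E fps_mulT add0r fpsDE.
    by rewrite fps_mulCE.
  by rewrite mul1r.
Qed.

Lemma F_P4_crossing_sum (n : nat) : F P4 n = crossing_sum 'X false (n + n) n n.
Proof.
case: n => [|n]; first by rewrite crossing_sum0.
apply: eq_big => [L|L]; first by rewrite inE.
by rewrite inE => /andP[/eqP EL /eqP NL]; rewrite mch_P4_crossings.
Qed.

Lemma unit2_polyrat : (2 : {poly rat}) \is a GRing.unit.
Proof. by rewrite -(rmorph_nat (@polyC rat)) rmorph_unit. Qed.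

Theorem mainTheorem6 :
  let x : fps {poly rat} := fpsC 'X in
  let t : fps {poly rat} := fpsT in
  let s : fps {poly rat} := fps_sqrt (1 - 4 * t) in
  F P3 = F P4 /\
  F P4 = 2 / (2 * t * (x - 1) + (s - 1) * x + s + 1).
Proof.
move=> x t s; split; first exact: (F_swap P4).
have U2 : (2 : fps {poly rat}) \is a GRing.unit.
  by rewrite fps_unitE unit2_polyrat.
have [s0 s2] : s 0%N = 1 /\ s ^+ 2 = 1 - 4 * t.
  apply: fps_sqrtP; first exact: unit2_polyrat.
  by rewrite fpsDE fpsNE fps_mul0E /= mulr0 subr0.
pose D : fps {poly rat} := (1 - s) / 2.
have sD : s = 1 - 2 * D by rewrite /D mulrC divrK //; ring.
have D0 : D 0%N = 0 by rewrite fps_mul0E fpsDE fpsNE s0 fps1E subrr mul0r.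
have DE : D = t + D ^+ 2.
  have U4 : (4 : fps {poly rat}) \is a GRing.unit.
    by rewrite (_ : 4 = 2 * 2) ?unitrM ?U2 //; ring.
  (* Completing the square: four times the equation is s^2 = 1 - 4t. *)
  apply: (mulrI U4); apply/eqP; rewrite -subr_eq0; apply/eqP.
  have : s ^+ 2 - (1 - 4 * t) = 0 by rewrite s2 subrr.
  rewrite sD => s2D.
  transitivity (- ((1 - 2 * D) ^+ 2 - (1 - 4 * t))); first by ring.
  by rewrite s2D oppr0.
clearbody D.
(* As [D] has constant term 0, shifting its coefficients divides it by [t]. *)
pose C : fps {poly rat} := Fps (fun n => D n.+1).
have tC : t * C = D by apply: fpsP => -[|n]; rewrite fps_mulT.
have CE : C = 1 + t * C ^+ 2.
  have tCE : t * C = t * (1 + t * C ^+ 2).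
    by rewrite {1}tC DE -tC; ring.
  apply: fpsP => n; have := congr1 (fun f => fps_coef f n.+1) tCE.
  by rewrite !fps_mulT.
pose Q : fps {poly rat} := 1 - 2 * D - (x - 1) * D ^+ 2.
have UQ : Q \is a GRing.unit.
  rewrite fps_unitE /Q !fpsDE !fpsNE !fps_mul0E D0 fps1E !(mulr0, mul0r) !subr0.
  exact: unitr1.
(* These solve the linear system [GfE], [GtE]: subtracting gives [Gt] in terms of [Gf], and
   substituting back gives [Q * Gf = 1]. *)
pose Gf := Q^-1; pose Gt := (1 + (x - 1) * D) * Gf.
have QGf : Q * Gf = 1 by exact: mulrV.
have GfE : Gf = 1 + t * (C * Gt + C * Gf).
  rewrite -QGf mulrDr !mulrA tC /Gt /Q; ring.
have GtE : Gt = 1 + t * (C * Gt + x * (C * Gf)).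
  have -> : t * (C * Gt + x * (C * Gf)) = D * Gt + x * (D * Gf).
    by rewrite -tC; ring.
  rewrite -QGf /Gt /Q; ring.
have -> : F P4 = Gf.
  apply: fpsP => n; rewrite F_P4_crossing_sum.
  by rewrite (crossing_sum_fps CE GfE GtE) // ltnn.
have -> : 2 * t * (x - 1) + (s - 1) * x + s + 1 = 2 * Q.
  have -> : t = D - D ^+ 2 by rewrite {1}DE addrK.
  by rewrite sD /Q; ring.
by rewrite invrM // mulrCA mulrV // mulr1.
Qed.
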